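(* Let $X_N=\{\boldsymbol{x}_1,\dots,\boldsymbol{x}_N\}\subset\mathbb{S}^2$ be a spherical $k$-design with $k\ge 2r$, let $\mathcal{B}_r=\{u_{\ell,m}: 0\le\ell\le r,\ -\ell\le m\le\ell\}$ be the basis of $\Pi_r(\mathbb{S}^2)$ given by the real spherical harmonics, and let $V_{N,r}\in\mathbb{R}^{N\times R}$, $R=(r+1)^2$, be the Vandermonde matrix obtained by evaluating the elements of $\mathcal{B}_r$ (columns) at the nodes of $X_N$ (rows). Then $$V_{N,r}^\top V_{N,r}=\frac{N}{4\pi}\,I.$$
   Context: $\mathbb{S}^2$ is the unit sphere in $\mathbb{R}^3$, $d\omega=\sin\varphi\,d\varphi\,d\theta$ is its surface measure, and $\Pi_k(\mathbb{S}^2)$ is the space of spherical polynomials of degree at most $k$. Convention of the paper: the $N$ nodes are distinct, $N=(n+1)^2$, and $r<n$. A finite set $X_N\subset\mathbb{S}^2$ is a spherical $k$-design if $\frac1N\sum_{i=1}^N p(\boldsymbol{x}_i)=\frac1{4\pi}\int_{\mathbb{S}^2}p\,d\omega$ for all $p\in\Pi_k(\mathbb{S}^2)$. Real spherical harmonics, in spherical coordinates $(\varphi,\theta)\in[0,\pi]\times[0,2\pi)$ ($\varphi$ the polar angle, $\theta$ the azimuth): $u_{\ell,m}=\sqrt2\,N_{\ell,m}P_\ell^m(\cos\varphi)\cos(m\theta)$ for $1\le m\le\ell$; $u_{\ell,0}=N_{\ell,0}P_\ell^0(\cos\varphi)$; $u_{\ell,m}=\sqrt2\,N_{\ell,|m|}P_\ell^{|m|}(\cos\varphi)\sin(|m|\theta)$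 for $-\ell\le m\le-1$, where $P_\ell^m$ is the associated Legendre function and $N_{\ell,m}=\sqrt{\frac{2\ell+1}{4\pi}\frac{(\ell-m)!}{(\ell+m)!}}$. With this normalization $\mathcal{B}_r$ is orthonormal in $L^2(\mathbb{S}^2)$ with respect to $d\omega$. *)

(* Defs.v *)
From HB Require Import structures.
From mathcomp Require Import all_boot all_order all_algebra.
From mathcomp Require Import all_classical all_reals all_analysis.
(* Notations are left out: they clash with those of mathcomp-analysis. *)
From mathcomp Require mpoly.
Import (canonicals, coercions) mpoly.
From mathcomp Require Import lra zify.

Set Implicit Arguments.
Unset Strict Implicit.
Unset Printing Implicit Defensive.

Import Order.TTheory GRing.Theory Num.Theory.
Import numFieldNormedType.Exports.

Local Open Scope classical_set_scope.
Local Open Scope ring_scope.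

Definition sphere (R : realType) : set 'rV[R]_3 :=
  [set x | x 0 0 ^+ 2 + x 0 1 ^+ 2 + x 0 2 ^+ 2 = 1].
Arguments sphere : clear implicits.

(* phi is the polar angle and theta the azimuth. *)
Definition sph_point (R : realType) (phi theta : R) : 'rV[R]_3 :=
  \row_(i < 3) [:: sin phi * cos theta; sin phi * sin theta; cos phi]`_i.

Definition polar (R : realType) (x : 'rV[R]_3) : R := acos (x 0 2).

(* At the poles, where the azimuth is not determined, the conventions
   a / 0 = 0 and acos 0 = pi / 2 make this equal to pi / 2. *)
Definition azimuth (R : realType) (x : 'rV[R]_3) : R :=
  let t := acos (x 0 0 / Num.sqrt (x 0 0 ^+ 2 + x 0 1 ^+ 2)) in
  if 0 <= x 0 1 then t else 2 * pi - t.

(* The integral of f over the unit sphere for the surface measure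
   sin(phi) dphi dtheta. *)
Definition sphere_integral (R : realType) (f : 'rV[R]_3 -> R) : R :=
  \int[(lebesgue_measure \x lebesgue_measure)%E]_(z in
      (`[0, pi]%classic `*` `[0, 2 * pi[%classic : set (R * R)))
    (f (sph_point z.1 z.2) * sin z.1).

(* The functions that agree on the sphere with a polynomial in three variables
   of total degree at most k (mpoly.msize is the total degree plus one). *)
Definition spherical_poly (R : realType) (k : nat) : set ('rV[R]_3 -> R) :=
  [set f | exists2 p : mpoly.mpoly 3 R, (mpoly.msize p <= k.+1)%N &
     forall x, sphere R x -> f x = mpoly.meval (fun i => x 0 i) p].

(* The set of nodes is enumerated by x; that its N elements are pairwise
   distinct is part of the definition. *)
Definition spherical_design (R : realType) (k N : nat)
    (x : 'I_N -> 'rV[R]_3) : Prop :=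
  [/\ injective x,
      forall i, sphere R (x i) &
      forall p : 'rV[R]_3 -> R, spherical_poly k p ->
        N%:R^-1 * (\sum_(i < N) p (x i)) = (4 * pi)^-1 * sphere_integral p].

(* Rodrigues' formula. *)
Definition legendre (R : realType) (l : nat) : {poly R} :=
  (2 ^+ l * (l`!)%:R)^-1 *: (('X^2 - 1) ^+ l)^`(l).
Arguments legendre : clear implicits.

(* P_l^m(t) = (-1)^m (1 - t^2)^(m/2) P_l^(m)(t), for t in [-1, 1]. *)
Definition assoc_legendre (R : realType) (l m : nat) (t : R) : R :=
  (-1) ^+ m * Num.sqrt (1 - t ^+ 2) ^+ m * (legendre R l)^`(m).[t].

Definition harmonic_norm (R : realType) (l m : nat) : R :=
  Num.sqrt ((2 * l%:R + 1) / (4 * pi) * (((l - m)`!)%:R / ((l + m)`!)%:R)).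
Arguments harmonic_norm : clear implicits.

Definition harmonic_coord (R : realType) (l : nat) (m : int)
    (phi theta : R) : R :=
  let a := `|m|%N in
  let c := harmonic_norm R l a * assoc_legendre l a (cos phi) in
  if m == 0 then c
  else if 0 < m then Num.sqrt 2 * c * cos (a%:R * theta)
  else Num.sqrt 2 * c * sin (a%:R * theta).

(* The choice of the azimuth at the poles is immaterial: there
   P_l^m(cos phi) = 0 for m >= 1. *)
Definition spherical_harmonic (R : realType) (l : nat) (m : int) (x : 'rV[R]_3) : R :=
  harmonic_coord l m (polar x) (azimuth x).

(* The pairs (l, m) with 0 <= l <= r and - l <= m <= l, in lexicographic
   order. *)
Definition harmonic_indices (r : nat) : seq (nat * int) :=
  [seq (l, k%:Z - l%:Z) | l <- iota 0 r.+1, k <- iota 0 l.*2.+1].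

Definition vandermonde (R : realType) (N r : nat) (x : 'I_N -> 'rV[R]_3) :
    'M[R]_(N, (r.+1 ^ 2)%N) :=
  \matrix_(i < N, j < (r.+1 ^ 2)%N)
    let lm := nth (0%N, 0) (harmonic_indices r) j in
    spherical_harmonic lm.1 lm.2 (x i).
Arguments vandermonde {R N} r x.

Lemma size_harmonic_indices r : size (harmonic_indices r) = (r.+1 ^ 2)%N.
Proof.
rewrite /harmonic_indices size_allpairs_dep.
elim: r => [//|r IHr].
rewrite -[in LHS](addn1 r.+1) iotaD map_cat sumn_cat IHr /= size_iota.
by rewrite -!mulnn; lia.
Qed.

Lemma harmonic_indices_uniq r : uniq (harmonic_indices r).
Proof.
apply: allpairs_uniq_dep => [|l _|]; rewrite ?iota_uniq //.
move=> [l k] [l' k'] _ _ /= [<-] /addIr[<-] //.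
Qed.

Lemma mem_harmonic_indices r l (m : int) :
  ((l, m) \in harmonic_indices r) = (l <= r)%N && (`|m| <= l)%N.
Proof.
apply/allpairsPdep/andP => [[l' [k]]|[lr ml]].
  by rewrite !mem_iota => -[h1 h2 [-> ->]]; split; lia.
exists l, (absz (m + l%:Z)%R); rewrite !mem_iota; split; [lia|lia|].
by congr pair; lia.
Qed.

Lemma azimuth_polarK (R : realType) (x : 'rV[R]_3) : sphere R x ->
  [/\ 0 <= polar x <= pi, 0 <= azimuth x < 2 * pi &
      sph_point (polar x) (azimuth x) = x].
Proof.
rewrite /sphere /= => Sx.
have sq_le1 (a : R) : a ^+ 2 <= 1 -> -1 <= a <= 1.
  by rewrite -ler_norml => a2; rewrite -(@expr_le1 _ 2)// real_normK ?num_real.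
have zB : -1 <= x 0 2 <= 1.
  by apply: sq_le1; rewrite -Sx lerDr addr_ge0 ?sqr_ge0.
set rho2 := x 0 0 ^+ 2 + x 0 1 ^+ 2 in Sx.
have rho2_ge0 : 0 <= rho2 by rewrite addr_ge0 ?sqr_ge0.
have sin_polar : sin (polar x) = Num.sqrt rho2.
  by rewrite sin_acos//; congr Num.sqrt; rewrite -Sx addrK.
set q := x 0 0 / Num.sqrt rho2.
have qB : -1 <= q <= 1.
  apply: sq_le1; rewrite expr_div_n sqr_sqrtr//.
  have [->|nz] := eqVneq rho2 0; first by rewrite invr0 mulr0.
  by rewrite ler_pdivrMr ?lt0r ?nz// mul1r lerDl sqr_ge0.
have rhoq : Num.sqrt rho2 * q = x 0 0.
  have [z|nz] := eqVneq (Num.sqrt rho2) 0; last by rewrite /q mulrCA divff ?mulr1.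
  rewrite z mul0r; apply/esym/eqP; rewrite -sqrf_eq0 eq_le sqr_ge0 andbT.
  have rho0 : rho2 = 0 by rewrite -(sqr_sqrtr rho2_ge0) z expr0n.
  by rewrite -[leRHS]rho0 lerDl sqr_ge0.
have rhos : Num.sqrt rho2 * Num.sqrt (1 - q ^+ 2) = `|x 0 1|.
  rewrite -sqrtrM// mulrBr mulr1 -[X in _ - X * _](sqr_sqrtr rho2_ge0).
  by rewrite -exprMn rhoq /rho2 addrAC subrr add0r sqrtr_sqr.
have piP := pi_gt0 R.
have q0 := acos_ge0 qB; have qpi := acos_lepi qB.
have azB : 0 <= azimuth x < 2 * pi.
  rewrite /azimuth -/rho2 -/q; case: ifPn => [_|]; first by apply/andP; split; lra.
  rewrite -ltNge => y0; apply/andP; split; first lra.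
  suff : acos q != 0 by move: q0; rewrite le_eqVlt eq_sym => /orP[->//|]; lra.
  apply/eqP => q_0; have q1 : q = 1 by rewrite -(acosK (x := q)) ?in_itv//= q_0 cos0.
  by move: rhos; rewrite q1 expr1n subrr sqrtr0 mulr0 => /esym/normr0_eq0; lra.
split=> //; first by rewrite acos_ge0// acos_lepi.
have cosaz : cos (azimuth x) = q.
  rewrite /azimuth -/rho2 -/q; case: ifP => _; last first.
    by rewrite mulr_natl addrC cosD2pi cosN acosK// in_itv.
  by rewrite acosK// in_itv.
have sinaz : Num.sqrt rho2 * sin (azimuth x) = x 0 1.
  rewrite /azimuth -/rho2 -/q; case: ifPn => [y0|].
    by rewrite sin_acos// rhos ger0_norm.
  rewrite -ltNge => y0.
  by rewrite mulr_natl addrC sinD2pi sinN sin_acos// mulrN rhos ltr0_norm// opprK.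
apply/rowP => i; rewrite mxE sin_polar cosaz rhoq sinaz /polar acosK ?in_itv//.
by case: i => -[|[|[|]]] //= ?; congr (x 0 _); apply/val_inj.
Qed.

(* Main.v *)
Require Import Defs.
From HB Require Import structures.
From mathcomp Require Import all_boot all_order all_algebra.
From mathcomp Require Import all_classical all_reals all_analysis.
From mathcomp Require Import measurable_realfun.
(* Notations are left out: they clash with those of mathcomp-analysis. *)
From mathcomp Require mpoly.
Import (canonicals, coercions) mpoly.
From mathcomp Require Import ring lra zify.

(* A product of two elements of B_r is a spherical polynomial of degree at most
   2r <= k, so the design property turns the entries of V^T V into N / (4 pi)
   times inner products in L^2(S^2), and it remains to see that the real
   spherical harmonics are orthonormal. Their inner products factor, by Fubini,
   into an azimuthal and a polar integral. The azimuthal functions T_m satisfy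
   T_m' = - m T_(-m), whence explicit primitives of the products T_m T_m'. The
   substitution t = cos(phi) turns the polar integral into the integral over
   [-1, 1] of (1 - t^2)^m P_l^(m) P_l'^(m), which is computed inside the ring of
   polynomials: m integrations by parts move all derivatives from P_l' to
   (1 - t^2)^m P_l^(m), giving a polynomial of degree l with known leading
   coefficient, and Rodrigues' formula integrates it against P_l' for l <= l'. *)

Set Implicit Arguments.
Unset Strict Implicit.
Unset Printing Implicit Defensive.

Import Order.TTheory GRing.Theory Num.Theory.
Import numFieldNormedType.Exports.

Local Open Scope classical_set_scope.
Local Open Scope ring_scope.

(** * Integrals of polynomials over [-1, 1] *)

Section PolynomialIntegral.
Variable F : realFieldType.
Implicit Types p q : {poly F}.

(** The coefficient of index 0 is a division by zero, hence 0: this is the primitive that vanishes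
    at 0. *)
Definition primitive p : {poly F} := \poly_(i < (size p).+1) (p`_i.-1 / i%:R).

Lemma coef_primitive p i : (primitive p)`_i = p`_i.-1 / i%:R.
Proof.
rewrite coef_poly; case: ltnP => // pi.
by rewrite nth_default ?mul0r//; case: i pi.
Qed.

Lemma deriv_primitive p : (primitive p)^`() = p.
Proof.
by apply/polyP => i; rewrite coef_deriv coef_primitive -[LHS]mulr_natr divfK// pnatr_eq0.
Qed.

(** The integral over [-1, 1], defined algebraically so that orthogonality becomes a computation
    with polynomials; [Rintegral_horner_cos] ties it to the Lebesgue integral. *)
Definition pint p : F := (primitive p).[1] - (primitive p).[-1].

Lemma pintD p q : pint (p + q) = pint p + pint q.
Proof.
rewrite /pint; have -> : primitive (p + q) = primitive p + primitive q.
  by apply/polyP => i; rewrite coefD !coef_primitive coefD mulrDl.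
by rewrite !hornerD; ring.
Qed.

Lemma pintZ a p : pint (a *: p) = a * pint p.
Proof.
rewrite /pint; have -> : primitive (a *: p) = a *: primitive p.
  by apply/polyP => i; rewrite coefZ !coef_primitive coefZ; ring.
by rewrite !hornerZ; ring.
Qed.

Lemma pint_deriv p : pint p^`() = p.[1] - p.[-1].
Proof.
suff Ep : p = primitive p^`() + (p`_0)%:P by rewrite [in RHS]Ep /pint !hornerE; ring.
apply/polyP => -[|i]; rewrite coefD coefC coef_primitive /=.
  by rewrite invr0 mulr0 add0r.
by rewrite coef_deriv -[_ *+ i.+1]mulr_natr mulfK ?addr0// pnatr_eq0.
Qed.

Lemma pint_parts p q : q.[1] = 0 -> q.[-1] = 0 ->
  pint (p * q^`()) = - pint (p^`() * q).
Proof.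
move=> q1 qN1; apply/eqP; rewrite -subr_eq0 opprK -pintD addrC -derivM.
by rewrite pint_deriv !hornerM q1 qN1 !mulr0 subrr.
Qed.

Lemma coefM_top p q a b : (size p <= a.+1)%N -> (size q <= b.+1)%N ->
  (p * q)`_(a + b) = p`_a * q`_b.
Proof.
move=> pa qb; have aP : (a < (a + b).+1)%N by lia.
rewrite coefM (bigD1 (Ordinal aP))//= addKn big1 ?addr0// => -[i iP] /=.
rewrite -val_eqE /= => ia; have [ai|ia'] := ltnP a i.
  by rewrite [p`__]nth_default ?mul0r// (leq_trans pa).
by rewrite [q`__]nth_default ?mulr0// (leq_trans qb)//; lia.
Qed.

Lemma derivn_const p l : (size p <= l.+1)%N -> p^`(l) = (p`_l * (l`!)%:R)%:P.
Proof.
move=> pl; apply/polyP => i; rewrite coef_derivn coefC.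
case: i => [|i] /=; first by rewrite addn0 ffactnn mulr_natr.
by rewrite nth_default ?mul0rn// (leq_trans pl)// addnS ltnS leq_addr.
Qed.

Definition weight : {poly F} := 1 - 'X^2.

Lemma weight_exp_root m : (0 < m)%N ->
  (weight ^+ m).[1] = 0 /\ (weight ^+ m).[-1] = 0.
Proof.
by move=> m0; rewrite !horner_exp !hornerE expr1n sqrrN expr1n subrr expr0n; case: m m0.
Qed.

Lemma size_weight_exp m : (size (weight ^+ m) <= m.*2.+1)%N.
Proof.
apply: (leq_trans (size_poly_exp_leq _ _)).
have : (size weight <= 3)%N.
  by apply: (leq_trans (size_polyD _ _)); rewrite size_polyN size_polyXn size_poly1.
nia.
Qed.

Lemma coef_weight_exp m : (weight ^+ m)`_(m.*2) = (-1) ^+ m.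
Proof.
elim: m => [|m IHm]; first by rewrite expr0 coef1.
rewrite !exprS doubleS -(addn2 m.*2) addnC coefM_top ?size_weight_exp//.
  by rewrite IHm coefB coef1 coefXn sub0r.
by have := size_weight_exp 1; rewrite expr1.
Qed.

(** Each differentiation uses up at most one factor [weight]. For positive [m] the derivative thus
    still vanishes at 1 and -1, as integration by parts requires. *)
Lemma derivn_weight_exp i m q :
  exists s, (weight ^+ (i + m) * q)^`(i) = weight ^+ m * s.
Proof.
elim: i m => [|i IHi] m; first by exists q.
have [s Es] := IHi m.+1; exists (weight^`() * s *+ m.+1 + weight * s^`()).
rewrite derivnS addSnnS Es derivM deriv_exp /= exprS; ring.
Qed.

Lemma pint_partsn n p q : pint (p * (weight ^+ n * q)^`(n)) =
  (-1) ^+ n * pint (p^`(n) * (weight ^+ n * q)).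
Proof.
(* Generalized for the induction: [i] derivatives have been moved and [j] remain. *)
suff H i j : (i + j)%N = n -> pint (p * (weight ^+ n * q)^`(n)) =
    (-1) ^+ i * pint (p^`(i) * (weight ^+ n * q)^`(j)).
  by rewrite (H n 0%N) ?addn0.
elim: i j => [|i IHi] j ijn; first by rewrite mul1r -ijn.
rewrite (IHi j.+1) -?addSnnS// derivnS pint_parts ?exprS; first by rewrite -derivnS; ring.
(* No boundary terms: as [n = i + 1 + j], the [j]-th derivative keeps the factor
   [weight ^+ i.+1]. *)
all: have [s ->] : exists s, (weight ^+ n * q)^`(j) = weight ^+ i.+1 * s
  by rewrite -ijn addnC; apply: derivn_weight_exp.
all: have [w1 wN1] := @weight_exp_root i.+1 isT.
all: by rewrite hornerM ?w1 ?wN1 mul0r.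
Qed.

(* [(1 - t^2)^(l+1) = (1 - t^2)^l - t * t (1 - t^2)^l], and the last term is
   integrated by parts. *)
Lemma pint_weightS l : (2 * l + 3)%:R * pint (weight ^+ l.+1) =
  (2 * l + 2)%:R * pint (weight ^+ l).
Proof.
have E : (weight ^+ l.+1)^`() = - (2 * l + 2)%:R *: ('X * weight ^+ l).
  rewrite deriv_exp /weight derivB derivXn derivC /= expr1 -mul_polyC.
  by rewrite polyCN polyC_natr; ring.
have [w1 wN1] := @weight_exp_root l.+1 isT.
have := pint_parts 'X w1 wN1; rewrite E derivX mul1r -scalerAr pintZ.
have -> : 'X * ('X * weight ^+ l) = weight ^+ l + (-1) *: weight ^+ l.+1.
  by rewrite scaleN1r exprS /weight; ring.
by rewrite pintD pintZ; lra.
Qed.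

(** Induction along the recurrence; the value is [2 ^+ (2 * l + 1)] times the Beta function at (l +
    1, l + 1). *)
Lemma pint_weight l : pint (weight ^+ l) =
  2 ^+ (2 * l + 1) * (l`!)%:R ^+ 2 / ((2 * l + 1)`!)%:R.
Proof.
elim: l => [|l IHl].
  have -> : weight ^+ 0 = ('X : {poly F})^`() by rewrite derivX.
  by rewrite pint_deriv !hornerE fact0 /= (_ : 1`! = 1%N)//; field.
have nz k : k.+1%:R != 0 :> F by rewrite pnatr_eq0.
have fnz k : (k`!)%:R != 0 :> F by rewrite pnatr_eq0 -lt0n fact_gt0.
apply: (mulfI (nz (2 * l + 2)%N)); rewrite -addnS pint_weightS IHl.
have -> : (2 * l.+1 + 1)%N = (2 * l + 1).+2 by lia.
rewrite !factS !natrM !exprS.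
move: (fnz (2 * l + 1)%N) (ler0n F l); move: (_`!%:R) => u u0 l0.
by field; rewrite u0 !gt_eqF//; lra.
Qed.

End PolynomialIntegral.
Arguments weight {F}.

(** * Legendre polynomials *)

Section LegendreOrthogonality.
Variable R : realType.
Implicit Types p q : {poly R}.

(** Rodrigues' formula in the form to which [pint_partsn] applies. *)
Lemma legendre_weight l : legendre R l =
  ((-1) ^+ l / (2 ^+ l * (l`!)%:R)) *: (weight ^+ l)^`(l).
Proof.
rewrite /legendre; have -> : 'X^2 - 1 = -1 *: weight :> {poly R}.
  by rewrite scaleN1r /weight opprB.
by rewrite exprZn derivnZ scalerA mulrC.
Qed.

(** After [l] integrations by parts only the [l]-th derivative of [q] is left, a constant, and the
    two signs cancel. For [q] of degree below [l] this is orthogonality. *)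
Lemma pint_legendre q l : (size q <= l.+1)%N ->
  pint (q * legendre R l) = q`_l / 2 ^+ l * pint (weight ^+ l : {poly R}).
Proof.
move=> ql; have nz : (l`!)%:R != 0 :> R by rewrite pnatr_eq0 -lt0n fact_gt0.
rewrite legendre_weight -scalerAr pintZ -[weight ^+ l]mulr1 pint_partsn mulr1.
rewrite (derivn_const ql) mul_polyC pintZ.
have : (-1) ^+ l * (-1) ^+ l = 1 :> R by rewrite -expr2 sqrr_sign.
move: ((-1) ^+ l) => e ee; move: (pint _) => J.
have -> : e / (2 ^+ l * (l`!)%:R) * (e * (q`_l * (l`!)%:R * J)) =
   (e * e) * (q`_l / 2 ^+ l * J) by field; rewrite nz expf_neq0.
by rewrite ee mul1r.
Qed.

Lemma size_legendre l : (size (legendre R l) <= l.+1)%N.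
Proof.
rewrite legendre_weight (leq_trans (size_scale_leq _ _))//.
apply/leq_sizeP => i li; rewrite coef_derivn nth_default ?mul0rn//.
by rewrite (leq_trans (size_weight_exp _ _))//; lia.
Qed.

Lemma coef_legendre l : (legendre R l)`_l = ((2 * l)`!)%:R / (2 ^+ l * (l`!)%:R ^+ 2).
Proof.
rewrite legendre_weight coefZ coef_derivn addnn coef_weight_exp.
have E : (l.*2 ^_ l * l`! = (2 * l)`!)%N.
  by rewrite mul2n -addnn -(@ffact_fact (l + l) l) ?leq_addr// addnK.
rewrite -E natrM; have nz : (l`!)%:R != 0 :> R by rewrite pnatr_eq0 -lt0n fact_gt0.
have : (-1) ^+ l * (-1) ^+ l = 1 :> R by rewrite -expr2 sqrr_sign.
move: ((-1) ^+ l) => e ee.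
transitivity ((e * e) * (l.*2 ^_ l)%:R / (2 ^+ l * (l`!)%:R)); first ring.
by rewrite ee; field; rewrite nz expf_neq0.
Qed.

(** The degree bound goes from [l] to [l - m], up to [l + m] and back to [l]. The two
    differentiations contribute l! / (l - m)! and (l + m)! / l!, the weight contributes the sign. *)
Lemma coef_derivn_weight_legendre l m : (m <= l)%N ->
  let D := (weight ^+ m * (legendre R l)^`(m))^`(m) in
  (size D <= l.+1)%N /\
  D`_l = (-1) ^+ m * (((l + m)`!)%:R / ((l - m)`!)%:R) * (legendre R l)`_l.
Proof.
move=> ml /=; set q := (legendre R l)^`(m).
have sq : (size q <= (l - m).+1)%N.
  apply/leq_sizeP => i li; rewrite coef_derivn nth_default ?mul0rn//.
  by rewrite (leq_trans (size_legendre _))//; lia.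
have sw := @size_weight_exp R m; split.
  apply/leq_sizeP => i li; rewrite coef_derivn nth_default ?mul0rn//.
  rewrite (leq_trans (size_polyMleq _ _))//.
  by move: sw sq; move: (size _) (size _) => a b; lia.
rewrite coef_derivn (_ : m + l = m.*2 + (l - m))%N; last lia.
rewrite coefM_top// coef_weight_exp coef_derivn subnKC//.
rewrite (_ : m.*2 + (l - m) = l + m)%N; last lia.
have E1 := ffact_fact ml; have := @ffact_fact (l + m) m (leq_addl _ _).
rewrite addnK => E2; rewrite -E2 -E1 !natrM.
have nz : ((l - m)`!)%:R != 0 :> R by rewrite pnatr_eq0 -lt0n fact_gt0.
by field.
Qed.

Lemma legendre_orthogonal l l' m : (m <= l)%N -> (m <= l')%N ->
  pint (weight ^+ m * ((legendre R l)^`(m) * (legendre R l')^`(m))) =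
  if l == l' then 2 / (2 * l + 1)%:R * (((l + m)`!)%:R / ((l - m)`!)%:R) else 0.
Proof.
wlog ll' : l l' / (l <= l')%N => [H ml ml'|ml ml'].
  have [ll'|] := leqP l l'; first exact: H.
  by move=> /ltnW l'l; rewrite [_^`(m) * _]mulrC H// eq_sym; case: eqVneq => // ->.
have [sD cD] := coef_derivn_weight_legendre ml.
set D := (_ ^`(m)) in sD cD.
have -> : pint (weight ^+ m * ((legendre R l)^`(m) * (legendre R l')^`(m))) =
    (-1) ^+ m * pint (D * legendre R l').
  rewrite [D * _]mulrC pint_partsn mulrA -expr2 sqrr_sign mul1r.
  by congr pint; ring.
rewrite pint_legendre ?(leq_trans sD)//.
(* For [l < l'] the coefficient of index [l'] of [D] is zero, since [D] has degree at most [l]. *)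
case: eqVneq => [El|ne]; last first.
  by rewrite (nth_default _ (leq_trans sD _)) ?mul0r ?mulr0//; lia.
rewrite -El cD coef_legendre pint_weight addn1 factS natrM.
rewrite [2 ^+ (2 * l).+1]exprS [(2 * l)%N]mulnC exprM.
have fnz k : (k`!)%:R != 0 :> R by rewrite pnatr_eq0 -lt0n fact_gt0.
move: (fnz l) (fnz (l - m)%N) (fnz (l * 2)%N) (ler0n R l).
have : (-1) ^+ m * (-1) ^+ m = 1 :> R by rewrite -expr2 sqrr_sign.
have : 2 ^+ l != 0 :> R by rewrite expf_neq0.
move: (2 ^+ l) ((-1) ^+ m) (l`!)%:R ((l - m)`!)%:R ((l + m)`!)%:R ((l * 2)`!)%:R.
move=> t e a b c d t0 ee a0 b0 d0 l0.
transitivity (e * e * (2 / (l * 2).+1%:R * (c / b))); last by rewrite ee mul1r.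
by field; rewrite t0 a0 b0 d0 gt_eqF//; lra.
Qed.
End LegendreOrthogonality.

(** * Integrals in spherical coordinates *)

(** The iterated integral of the absolute value is a product of two finite integrals, so the product
    is integrable by Tonelli and Fubini applies. *)
Lemma Rintegral_prod d1 d2 (T1 : measurableType d1) (T2 : measurableType d2)
    (R : realType) (m1 : {sigma_finite_measure set T1 -> \bar R})
    (m2 : {sigma_finite_measure set T2 -> \bar R}) (f : T1 -> R) (g : T2 -> R) :
  m1.-integrable setT (EFin \o f) -> m2.-integrable setT (EFin \o g) ->
  \int[(m1 \x m2)%E]_z (f z.1 * g z.2) = (\int[m1]_x f x) * (\int[m2]_y g y).
Proof.
move=> intf intg.
have mf : measurable_fun setT f by exact/measurable_EFinP/(measurable_int _ intf).
have mg : measurable_fun setT g by exact/measurable_EFinP/(measurable_int _ intg).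
have mfg : measurable_fun setT (fun z : T1 * T2 => f z.1 * g z.2).
  by apply: measurable_funM; [exact: measurableT_comp mf measurable_fst
                             |exact: measurableT_comp mg measurable_snd].
have intfg : (m1 \x m2)%E.-integrable setT (EFin \o (fun z : T1 * T2 => f z.1 * g z.2)).
  apply/integrable12ltyP => /=; first exact/measurable_EFinP.
  under eq_integral => x _.
    under eq_integral => y _ do rewrite normrM EFinM.
    rewrite integralZl//; last exact: integrable_abse intg.
    over.
  have intNg := integrable_fin_num measurableT (integrable_abse intg).
  rewrite -(fineK intNg) /= integralZr//; last exact: integrable_abse intf.
  have intNf := integrable_fin_num measurableT (integrable_abse intf).
  by rewrite -(fineK intNf) -EFinM ltry.
rewrite /Rintegral -(integral12_prod_meas1 intfg) /fubini_F /=.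
have Eg : (\int[m2]_y (g y)%:E = (\int[m2]_y g y)%:E)%E.
  by rewrite fineK// (integrable_fin_num measurableT).
have Ef : (\int[m1]_x (f x)%:E = (\int[m1]_x f x)%:E)%E.
  by rewrite fineK// (integrable_fin_num measurableT).
transitivity (fine (\int[m1]_x ((f x)%:E * (\int[m2]_y g y)%:E))%E).
  congr fine; apply: eq_integral => x _.
  by under eq_integral => y _ do rewrite EFinM; rewrite integralZl// Eg.
by rewrite integralZr// Ef -EFinM.
Qed.

Section Integrals.
Variable R : realType.
Let leb := @lebesgue_measure R.

Lemma Rintegral_FTC (f F : R -> R) (a b : R) : a < b -> continuous f ->
  (forall x, is_derive x (1 : R) F (f x)) ->
  \int[leb]_(x in `[a, b]) f x = F b - F a.
Proof.
move=> ab cf dF; have cF : continuous F.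
  by move=> x; apply/differentiable_continuous/derivable1_diffP; have [] := dF x.
rewrite /Rintegral (@continuous_FTC2 _ f F)//.
- exact: continuous_subspaceT.
- split; first by move=> x _; have [] := dF x.
    by apply: cvg_at_right_filter; exact: cF.
  by apply: cvg_at_left_filter; exact: cF.
- by move=> x _; rewrite derive1E; have [_ ->] := dF x.
Qed.

Lemma Rintegral_prod_itv (f g : R -> R) (a b c d : R) :
  continuous f -> continuous g ->
  \int[(leb \x leb)%E]_(z in (`[a, b]%classic `*` `[c, d[%classic : set (R * R)))
     (f z.1 * g z.2) =
  (\int[leb]_(x in `[a, b]) f x) * (\int[leb]_(y in `[c, d]) g y).
Proof.
move=> cf cg.
have intf : leb.-integrable `[a, b] (EFin \o f).
  apply: continuous_compact_integrable; first exact: segment_compact.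
  exact: continuous_subspaceT.
have intg : leb.-integrable `[c, d[ (EFin \o g).
  have : leb.-integrable `[c, d] (EFin \o g).
    apply: continuous_compact_integrable; first exact: segment_compact.
    exact: continuous_subspaceT.
  by apply: integrableS => //; apply: subset_itvl; rewrite bnd_simp.
(* The right endpoint of the azimuth range is a null set. *)
rewrite -[X in _ * X]Rintegral_itv_bndo_bndc//.
(* The integrands are extended by zero; the indicator function of a rectangle is a product, so
   [Rintegral_prod] applies. *)
rewrite Rintegral_mkcond [in RHS]Rintegral_mkcond [X in _ * X]Rintegral_mkcond.
rewrite -Rintegral_prod; last 2 first.
- by move: intf; rewrite integrable_mkcond// restrict_EFin.
- by move: intg; rewrite integrable_mkcond// restrict_EFin.
apply: eq_Rintegral => -[x y] _ /=; rewrite /patch in_setX/=.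
by do 2 case: (_ \in _) => //=; rewrite ?mul0r ?mulr0.
Qed.
End Integrals.

(** * The polar and the azimuthal integral *)

Section AngularIntegrals.
Variable R : realType.
Let leb := @lebesgue_measure R.

(** Substitution of the cosine: minus [primitive p] composed with [cos] is an antiderivative of the
    integrand. *)
Lemma Rintegral_horner_cos (p : {poly R}) :
  \int[leb]_(t in `[0, pi]) (p.[cos t] * sin t) = pint p.
Proof.
have cf : continuous (fun t : R => p.[cos t] * sin t).
  move=> t; apply: cvgM; last exact: continuous_sin.
  by apply: continuous_comp; [exact: continuous_cos|exact: continuous_horner].
have dF t : is_derive t (1 : R) (fun t => - (primitive p).[cos t]) (p.[cos t] * sin t).
  rewrite -[p in p.[_]]deriv_primitive -[_ * sin t]opprK -mulrN.
  by apply: is_deriveN; apply: is_derive1_comp.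
by rewrite (Rintegral_FTC (pi_gt0 R) cf dF) cospi cos0 /pint; ring.
Qed.

(** The azimuthal factor of [harmonic_coord], with the square root of 2 included so that every
    square has integral [2 * pi]. *)
Definition trig (m : int) (t : R) : R :=
  if m == 0 then 1
  else if 0 < m then Num.sqrt 2 * cos (`|m|%N%:R * t)
  else Num.sqrt 2 * sin (`|m|%N%:R * t).

(** Negating [m] exchanges cosine and sine, and the sign of [m] supplies that of the derivative, so
    one formula covers all cases. *)
Lemma is_derive_trig m t : is_derive t (1 : R) (trig m) (- m%:~R * trig (- m) t).
Proof.
have dM a : is_derive t (1 : R) ( *%R a) a.
  have -> : *%R a = a \*: (@id R) by [].
  by rewrite -[X in is_derive _ _ _ X]mulr1; apply: is_deriveZ.
case: (ltrgt0P m) => [m0|m0|->]; last first.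
- rewrite oppr0 mul0r /trig eqxx; exact: is_derive_cst.
- have a : m = - `|m|%N%:Z by lia.
  have -> : trig m = Num.sqrt 2 \*: (sin \o *%R `|m|%N%:R).
    by apply/funext => u; rewrite /trig lt_eqF// ltNge (ltW m0).
  have -> : - m%:~R * trig (- m) t = Num.sqrt 2 *: (cos (`|m|%N%:R * t) * `|m|%N%:R).
    rewrite /trig oppr_eq0 lt_eqF// oppr_gt0 m0 abszN {1}a mulrNz opprK /=.
    by rewrite /GRing.scale/=; ring.
  by apply: is_deriveZ; apply: is_derive1_comp.
- have a : m = `|m|%N%:Z by lia.
  have -> : trig m = Num.sqrt 2 \*: (cos \o *%R `|m|%N%:R).
    by apply/funext => u; rewrite /trig gt_eqF// m0.
  have -> : - m%:~R * trig (- m) t = Num.sqrt 2 *: (- sin (`|m|%N%:R * t) * `|m|%N%:R).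
    rewrite /trig oppr_eq0 gt_eqF// oppr_gt0 ltNge (ltW m0)/= abszN {1}a /=.
    by rewrite /GRing.scale/=; ring.
  by apply: is_deriveZ; apply: is_derive1_comp.
Qed.

Lemma continuous_trig m : continuous (trig m).
Proof.
move=> t; apply/differentiable_continuous/derivable1_diffP.
by have [] := is_derive_trig m t.
Qed.

Lemma trig_2pi m : trig m (2 * pi) = trig m 0.
Proof.
rewrite /trig !mulr0 cos0 sin0; case: ifP => // _.
have cp n : cos (n%:R * (2 * pi)) = 1 :> R /\ sin (n%:R * (2 * pi)) = 0 :> R.
  elim: n => [|n [IHc IHs]]; first by rewrite mul0r cos0 sin0.
  have -> : n.+1%:R * (2 * pi) = n%:R * (2 * pi) + pi *+ 2 :> R by ring.
  by rewrite cosD2pi sinD2pi IHc IHs.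
by have [-> ->] := cp `|m|%N; rewrite mulr1 mulr0.
Qed.

Lemma trig_sq m t : m != 0 -> trig m t ^+ 2 + trig (- m) t ^+ 2 = 2.
Proof.
move=> m0; rewrite /trig oppr_eq0 (negbTE m0) oppr_gt0 abszN.
have s2 : Num.sqrt 2 ^+ 2 = 2 :> R by rewrite sqr_sqrtr.
have cs := cos2Dsin2 (`|m|%N%:R * t).
case: (ltrgt0P m) m0 => // _ _; rewrite !exprMn -mulrDr s2 ?cs ?mulr1//.
by rewrite addrC cs mulr1.
Qed.

Lemma trig_orthogonal m m' :
  \int[leb]_(t in `[0, 2 * pi]) (trig m t * trig m' t) = if m == m' then 2 * pi else 0.
Proof.
have pi2 : 0 < 2 * pi :> R by rewrite mulr_gt0// pi_gt0.
have dprod k k' t : is_derive t (1 : R) (fun t => trig k t * trig k' t)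
    (trig k t *: (- k'%:~R * trig (- k') t) + trig k' t *: (- k%:~R * trig (- k) t)).
  by apply: is_deriveM; exact: is_derive_trig.
have FTC (F : R -> R) (c : R) :
    (forall t, is_derive t (1 : R) F (trig m t * trig m' t)) ->
    F (2 * pi) - F 0 = c ->
    \int[leb]_(t in `[0, 2 * pi]) (trig m t * trig m' t) = c.
  move=> dF <-; apply: Rintegral_FTC => //.
  by move=> t; apply: cvgM; exact: continuous_trig.
(* [trig k] satisfies [f'' = - k^2 f], so [(m^2 - m'^2) trig m * trig m'] is the
   derivative of a Wronskian. *)
have [/eqP sq|sq] := boolP (m ^+ 2 == m' ^+ 2); last first.
  have nz : (m ^+ 2 - m' ^+ 2)%:~R != 0 :> R by rewrite intr_eq0 subr_eq0.
  have -> : (m == m') = false by apply: contraNF sq => /eqP->.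
  apply: (FTC (fun t => ((m ^+ 2 - m' ^+ 2)%:~R)^-1 *
    (m%:~R * (trig (- m) t * trig m' t) + - m'%:~R * (trig m t * trig (- m') t)))).
    move=> t; apply: is_derive_eq.
    rewrite !opprK /GRing.scale/= !rmorphN/=.
    move: nz; rewrite rmorphB !rmorphXn/= => nz.
    by field.
  by rewrite !trig_2pi subrr.
(* Equal squares leave three cases: both indices zero, [m' = m], and [m' = - m]. *)
have [z|m0] := eqVneq m 0.
  have z' : m' = 0 by apply/eqP; rewrite -sqrf_eq0 -sq z expr0n.
  have -> : (m == m') = true by rewrite z z'.
  apply: (FTC id); last by rewrite subr0.
  by move=> t; rewrite z z' /trig eqxx mulr1; exact: is_derive_id.
have nz : m%:~R != 0 :> R by rewrite intr_eq0.
have [mm'|ne] := eqVneq m m'.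
  (* With [u = trig m] and [v = trig (- m)], (u v)' = m (u^2 - v^2) and u^2 + v^2 = 2, hence u^2 = 1
     + (u v)' / (2 m). *)
  apply: (FTC (fun t => t + (2 * m%:~R)^-1 * (trig (- m) t * trig m t))).
    move=> t; apply: is_derive_eq.
    rewrite -mm' !opprK /GRing.scale/= !rmorphN/=.
    have := trig_sq t m0; move: (trig m t) (trig (- m) t) => u v uv.
    transitivity (1 + (2 * m%:~R)^-1 * (m%:~R * (2 * u ^+ 2 - (u ^+ 2 + v ^+ 2)))).
      by ring.
    by rewrite uv; field.
  by rewrite !trig_2pi; ring.
have m'E : m' = - m.
  by move/eqP: sq; rewrite eqf_sqr (negbTE ne) /= => /eqP->; rewrite opprK.
(* The integrand [trig m * trig (- m)] is a multiple of the derivative of the square of [trig m]. *)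
apply: (FTC (fun t => (- 2 * m%:~R)^-1 * (trig m t * trig m t))); last first.
  by rewrite !trig_2pi subrr.
move=> t; apply: is_derive_eq.
by rewrite m'E /GRing.scale/=; field.
Qed.
End AngularIntegrals.

(** * Spherical harmonics as spherical polynomials *)

Section SphericalPolynomials.
Variable R : realType.
Implicit Types f g : 'rV[R]_3 -> R.

Lemma spherical_polyW a b f : (a <= b)%N -> spherical_poly a f -> spherical_poly b f.
Proof. by move=> ab [p sp fp]; exists p => //; rewrite (leq_trans sp). Qed.

Lemma spherical_polyC a (c : R) : spherical_poly a (fun _ : 'rV[R]_3 => c).
Proof.
exists (mpoly.mpolyC 3 c) => [|x _]; last by rewrite mpoly.mevalC.
by rewrite mpoly.msizeC; case: (c != 0).
Qed.

Lemma spherical_poly_coord i : spherical_poly 1 (fun x : 'rV[R]_3 => x 0 i).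
Proof.
exists (mpoly.mpolyX R (mpoly.mnm1 i)) => [|x _]; last by rewrite mpoly.mevalXU.
by rewrite mpoly.msizeX mpoly.mdeg1.
Qed.

Lemma spherical_polyD a f g : spherical_poly a f -> spherical_poly a g ->
  spherical_poly a (fun x => f x + g x).
Proof.
move=> [p sp fp] [q sq gq]; exists (p + q) => [|x Sx].
  by rewrite (leq_trans (mpoly.msizeD_le _ _))// geq_max sp.
by rewrite mpoly.mevalD fp ?gq.
Qed.

Lemma spherical_polyM a b f g : spherical_poly a f -> spherical_poly b g ->
  spherical_poly (a + b) (fun x => f x * g x).
Proof.
move=> [p sp fp] [q sq gq]; exists (p * q) => [|x Sx];
  last by rewrite mpoly.mevalM fp ?gq.
(* [msizeM] concerns nonzero factors, so zero polynomials are treated apart. *)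
have [->|p0] := eqVneq p 0; first by rewrite mul0r mpoly.msize0.
have [->|q0] := eqVneq q 0; first by rewrite mulr0 mpoly.msize0.
rewrite mpoly.msizeM//; move: sp sq.
by move: (mpoly.mmeasure _ p) (mpoly.mmeasure _ q) => u v; lia.
Qed.

Lemma spherical_polyX a n f :
  spherical_poly a f -> spherical_poly (n * a) (fun x => f x ^+ n).
Proof.
move=> fa; elim: n => [|n IHn]; first exact: spherical_polyC.
have := spherical_polyM fa IHn; rewrite -mulSn.
by congr (spherical_poly _ _); apply/funext => x; rewrite exprS.
Qed.

Lemma spherical_poly_horner d (q : {poly R}) i : (size q <= d.+1)%N ->
  spherical_poly d (fun x : 'rV[R]_3 => q.[x 0 i]).
Proof.
move=> qd; have -> : (fun x : 'rV[R]_3 => q.[x 0 i]) =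
    fun x => \sum_(j < d.+1) q`_j * x 0 i ^+ j.
  by apply/funext => x; rewrite (horner_coef_wide _ qd).
have H (s : seq 'I_d.+1) :
    spherical_poly d (fun x : 'rV[R]_3 => \sum_(j <- s) q`_j * x 0 i ^+ j).
  elim: s => [|j s IHs].
    under eq_fun do rewrite big_nil; exact: spherical_polyC.
  under eq_fun do rewrite big_cons.
  apply: spherical_polyD IHs; apply: (@spherical_polyW (0 + j * 1)).
    by rewrite muln1 add0n -ltnS ltn_ord.
  apply: spherical_polyM; first exact: spherical_polyC.
  exact: spherical_polyX (spherical_poly_coord _).
exact: H.
Qed.

(* [cos (a t)] and [sin (a t)], scaled by [sin p ^ a], are the real and
   imaginary parts of [(x + i y)^a]. *)
Lemma spherical_poly_azimuth a :
  (exists2 f, spherical_poly a f &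
    forall p t : R, f (sph_point p t) = sin p ^+ a * cos (a%:R * t)) /\
  (exists2 f, spherical_poly a f &
    forall p t : R, f (sph_point p t) = sin p ^+ a * sin (a%:R * t)).
Proof.
elim: a => [|a [[f fa Ef] [g ga Eg]]].
  split; [exists (fun=> 1)|exists (fun=> 0)]; try exact: spherical_polyC.
    by move=> p t; rewrite mul0r cos0 mulr1.
  by move=> p t; rewrite mul0r sin0 mulr0.
have sp i : spherical_poly 1 (fun x : 'rV[R]_3 => x 0 i) := spherical_poly_coord i.
have E p t : @sph_point R p t 0 0 = sin p * cos t /\
    @sph_point R p t 0 1 = sin p * sin t.
  by rewrite !mxE.
split.
  exists (fun x : 'rV[R]_3 => x 0 0 * f x + (- 1) * x 0 1 * g x).
    rewrite -add1n; apply: spherical_polyD; first exact: spherical_polyM.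
    exact: spherical_polyM (spherical_polyM (spherical_polyC 0 _) _) _.
  move=> p t; have [-> ->] := E p t; rewrite Ef Eg -natr1 mulrDl mul1r cosD exprS; ring.
exists (fun x : 'rV[R]_3 => x 0 0 * g x + x 0 1 * f x).
  by rewrite -add1n; apply: spherical_polyD; exact: spherical_polyM.
move=> p t; have [-> ->] := E p t; rewrite Ef Eg -natr1 mulrDl mul1r sinD exprS; ring.
Qed.

Lemma spherical_poly_trig (m : int) : exists2 f, spherical_poly `|m|%N f &
  forall p t : R, f (sph_point p t) = sin p ^+ `|m|%N * trig m t.
Proof.
have [[f fa Ef] [g ga Eg]] := spherical_poly_azimuth `|m|%N.
rewrite /trig; case: (eqVneq m 0) => [->|_].
  by exists (fun=> 1) => [|p t]; [exact: spherical_polyC|rewrite expr0 mulr1].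
case: (0 < m).
  exists (fun x : 'rV[R]_3 => Num.sqrt 2 * f x) => [|p t]; last by rewrite Ef; ring.
  exact: spherical_polyM (spherical_polyC 0 _) fa.
exists (fun x : 'rV[R]_3 => Num.sqrt 2 * g x) => [|p t]; last by rewrite Eg; ring.
exact: spherical_polyM (spherical_polyC 0 _) ga.
Qed.

(** For nonnegative [sin p] the square root in [assoc_legendre] equals [sin p]. Its power is grouped
    with [trig] because together they are polynomial in the Cartesian coordinates. *)
Lemma harmonic_coordE l m (p t : R) : 0 <= sin p -> harmonic_coord l m p t =
  harmonic_norm R l `|m| * (-1) ^+ `|m|%N * (legendre R l)^`(`|m|).[cos p] *
  (sin p ^+ `|m|%N * trig m t).
Proof.
move=> p0; have E : assoc_legendre l `|m| (cos p) =
    (-1) ^+ `|m|%N * sin p ^+ `|m|%N * (legendre R l)^`(`|m|).[cos p].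
  rewrite /assoc_legendre; congr (_ * _ ^+ _ * _).
  by rewrite -sin2cos2 sqrtr_sqr ger0_norm.
rewrite /harmonic_coord E /trig.
by case: ifP => [/eqP->|_]; [rewrite /= |case: ifP => _]; ring.
Qed.

(** The derivative of the Legendre polynomial, in the third coordinate, accounts for degree
    [l - |m|], the azimuthal factor for [|m|]. *)
Lemma spherical_poly_harmonic_coord l m : (`|m| <= l)%N ->
  exists2 f, spherical_poly l f &
    forall p t : R, 0 <= sin p -> f (sph_point p t) = harmonic_coord l m p t.
Proof.
move=> ml; have [f fm Ef] := spherical_poly_trig m.
exists (fun x : 'rV[R]_3 =>
  harmonic_norm R l `|m| * (-1) ^+ `|m|%N * (legendre R l)^`(`|m|).[x 0 2] * f x).
  rewrite -(subnK ml); apply: spherical_polyM fm.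
  apply: (spherical_polyM (spherical_polyC 0 _)); apply: spherical_poly_horner.
  rewrite subnK//; apply/leq_sizeP => i li; rewrite coef_derivn nth_default ?mul0rn//.
  by rewrite (leq_trans (size_legendre _ _))//; lia.
by move=> p t p0; rewrite harmonic_coordE// Ef mxE.
Qed.

Lemma sphere_sph_point (p t : R) : sphere R (sph_point p t).
Proof.
rewrite /sphere /= !mxE /= !exprMn -mulrDr cos2Dsin2 mulr1 addrC cos2Dsin2//.
Qed.

Lemma sin_polar_ge0 x : sphere R x -> 0 <= sin (polar x).
Proof. by case/azimuth_polarK => px _ _; rewrite sin_ge0_pi// in_itv. Qed.

Lemma spherical_poly_harmonic l m : (`|m| <= l)%N ->
  spherical_poly l (@spherical_harmonic R l m).
Proof.
move=> /spherical_poly_harmonic_coord[f [q sq fq] Ef]; exists q => // x Sx.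
have [_ _ Ex] := azimuth_polarK Sx.
by rewrite -fq// /spherical_harmonic -Ef ?Ex// sin_polar_ge0.
Qed.

(** The coordinates [p], [t] may differ from those that [polar] and [azimuth] assign to the point,
    but both sides are the value there of one function of the point. *)
Lemma spherical_harmonic_sph_point l m (p t : R) : (`|m| <= l)%N -> 0 <= sin p ->
  spherical_harmonic l m (sph_point p t) = harmonic_coord l m p t.
Proof.
move=> /spherical_poly_harmonic_coord[f _ Ef] p0.
have S := sphere_sph_point p t; have [_ _ Ex] := azimuth_polarK S.
by rewrite /spherical_harmonic -Ef ?sin_polar_ge0// Ex Ef.
Qed.
End SphericalPolynomials.

(** * Orthonormality and the Gram matrix *)

Lemma spherical_harmonic_orthonormal (R : realType) l l' (m m' : int) :
  (`|m| <= l)%N -> (`|m'| <= l')%N ->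
  sphere_integral (fun x : 'rV[R]_3 =>
    spherical_harmonic l m x * spherical_harmonic l' m' x) =
  ((l, m) == (l', m'))%:R.
Proof.
move=> ml ml'; set a := `|m|%N; set a' := `|m'|%N.
pose c := harmonic_norm R l a * (-1) ^+ a; pose c' := harmonic_norm R l' a' * (-1) ^+ a'.
pose P := (legendre R l)^`(a); pose P' := (legendre R l')^`(a').
(* The polar factor; the last [sin p] is the density of the surface measure. *)
pose F (p : R) := (c * P.[cos p] * sin p ^+ a) * (c' * P'.[cos p] * sin p ^+ a') * sin p.
have sF : sphere_integral (fun x : 'rV[R]_3 =>
      spherical_harmonic l m x * spherical_harmonic l' m' x) =
    \int[lebesgue_measure]_(p in `[0, pi]) F p * (if m == m' then 2 * pi else 0).
  rewrite -trig_orthogonal -Rintegral_prod_itv; last 2 first.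
  - have cP (q : {poly R}) : continuous (fun p : R => q.[cos p]).
      move=> p; apply: continuous_comp; first exact: continuous_cos.
      exact: continuous_horner.
    have cX n : continuous (fun p : R => sin p ^+ n).
      move=> p; apply: (@continuous_comp _ _ _ sin (fun y : R => y ^+ n)).
        exact: continuous_sin.
      exact: exprn_continuous.
    move=> p; apply: cvgM; last exact: continuous_sin.
    by apply: cvgM; (apply: cvgM; [apply: cvgM; [exact: cvg_cst|exact: cP]|exact: cX]).
  - by move=> t; apply: cvgM; exact: continuous_trig.
  apply: eq_Rintegral => -[p t]; rewrite inE /= => -[/= pI tI].
  have p0 : 0 <= sin p by rewrite sin_ge0_pi.
  by rewrite !spherical_harmonic_sph_point// !harmonic_coordE// /F /c /c' /P /P'; ring.
rewrite sF xpair_eqE; case: eqVneq => [mm'|_]; last by rewrite mulr0 andbF.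
rewrite andbT.
have aa' : a' = a by rewrite /a' -mm'.
(* As [a' = a], the powers of the sine combine into [weight ^+ a] at [cos p], and the remaining sine
   is absorbed by the substitution. *)
have -> : \int[lebesgue_measure]_(p in `[0, pi]) F p =
    pint (c * c' *: (weight ^+ a * (P * P'))).
  rewrite -Rintegral_horner_cos; apply: eq_Rintegral => p _.
  have wc : weight.[cos p] = sin p ^+ 2 by rewrite /weight !hornerE sin2cos2.
  by rewrite /F aa' !(hornerZ, hornerM, horner_exp) wc exprAC expr2; ring.
rewrite pintZ /P /P' aa' legendre_orthogonal//; last by rewrite -aa'.
case: eqVneq => [ll'|_]; last by rewrite mulr0 mul0r.
rewrite /c /c' aa' -ll'.
have ee : (-1) ^+ a * (-1) ^+ a = 1 :> R by rewrite -expr2 sqrr_sign.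
have nn : harmonic_norm R l a * harmonic_norm R l a =
    (2 * l%:R + 1) / (4 * pi) * (((l - a)`!)%:R / ((l + a)`!)%:R).
  rewrite -expr2 sqr_sqrtr// mulr_ge0 ?divr_ge0 ?ler0n// ?addr_ge0 ?mulr_ge0 ?pi_ge0//.
(* The signs square to 1, and the normalization cancels the Legendre norm times [2 * pi]. *)
transitivity ((harmonic_norm R l a * harmonic_norm R l a) * ((-1) ^+ a * (-1) ^+ a) *
  (2 / (2 * l + 1)%:R * (((l + a)`!)%:R / ((l - a)`!)%:R)) * (2 * pi)); first ring.
have fnz k : (k`!)%:R != 0 :> R by rewrite pnatr_eq0 -lt0n fact_gt0.
rewrite nn ee; move: (fnz (l - a)%N) (fnz (l + a)%N) (ler0n R l) (pi_gt0 R).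
move: ((l - a)`!)%:R ((l + a)`!)%:R => u v u0 v0 l0 pi0.
by rewrite /= mulr1n; field; rewrite u0 v0 !gt_eqF//; lra.
Qed.

Theorem corollary2 (R : realType) (n r k N : nat) (x : 'I_N -> 'rV[R]_3)
    (hN : N = (n.+1 ^ 2)%N) (hrn : (r < n)%N) (hk : (2 * r <= k)%N)
    (hx : spherical_design k x) :
  (vandermonde r x)^T *m vandermonde r x = (N%:R / (4 * pi))%:M.
Proof.
have [_ _ design] := hx.
have N0 : N%:R != 0 :> R by rewrite hN pnatr_eq0 expn_eq0.
apply/matrixP => i j; rewrite !mxE; under eq_bigr do rewrite !mxE.
set u := nth _ _ i; set v := nth _ _ j.
have sI (h : 'I_(r.+1 ^ 2)) : (h < size (harmonic_indices r))%N.
  by rewrite size_harmonic_indices.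
have [ul um] : (u.1 <= r)%N /\ (`|u.2| <= u.1)%N.
  apply/andP; rewrite -mem_harmonic_indices -surjective_pairing; exact: mem_nth.
have [vl vm] : (v.1 <= r)%N /\ (`|v.2| <= v.1)%N.
  apply/andP; rewrite -mem_harmonic_indices -surjective_pairing; exact: mem_nth.
have uv : (u == v) = (i == j) by rewrite nth_uniq ?harmonic_indices_uniq.
(* The mean over the nodes of a product of two columns becomes an inner product of harmonics divided
   by [4 * pi]. *)
have := design (fun x => spherical_harmonic u.1 u.2 x * spherical_harmonic v.1 v.2 x).
rewrite spherical_harmonic_orthonormal// -!surjective_pairing uv => H.
(* The entry is [N] times that mean; what remains is the degree bound u.1 + v.1 <= 2 r <= k. *)
rewrite -[LHS](mulVKf N0) H; first by rewrite -[RHS]mulr_natr mulrA.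
apply: (@spherical_polyW _ (u.1 + v.1)); first by lia.
by apply: spherical_polyM; exact: spherical_poly_harmonic.
Qed.
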